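(* Let $n \ge 0$ be an integer and let $(X,d)$ be a metric space of asymptotic dimension at most $n$. Then $(X,d)$ is coarsely equivalent to a metric space $(Y,D)$ that satisfies property $(N2)_n$, that is: for every $x, y_1, \dots, y_{n+2} \in Y$ there exist $i, j \in \{1, \dots, n+2\}$ with $i \neq j$ such that $D(y_i, y_j) \le D(x, y_i)$.
   Context: Asymptotic dimension: for a metric space $(X,d)$, a family $\mathcal{U}$ of subsets of $X$ is $r$-disjoint if for every two different $U, V \in \mathcal{U}$ one has $d(U,V) > r$, where $d(U,V) = \inf\{d(u,v) : u \in U, v \in V\}$. A family of subsets is uniformly bounded if the supremum of the diameters of its members is finite. $(X,d)$ has asymptotic dimension at most $n$ (written $\mathrm{asdim}(X,d) \le n$) if for every $r > 0$ there exists a uniformly bounded covering $\mathcal{U}$ of $X$ by subsets of $X$ that splits as a union $\mathcal{U} = \bigcup_{i=1}^{n+1} \mathcal{U}^i$ where each $\mathcal{U}^i$ is an $r$-disjoint family. Coarse equivalence: a map $f : (X, d_X) \to (Y, d_Y)$ between metric spaces is a coarse map if for every $\delta > 0$ there is an $\epsilon > 0$ such that for all $a, b \in X$ with $d_X(a,b) \le \delta$ one has $d_Y(f(a), f(b)) \le \epsilon$. A coarse map $f$ is a coarse equivalence if there exist a coarse map $g : (Y, d_Y) \to (X, d_X)$ and a constant $C > 0$ such that $d_X(x, g(f(x))) \le C$ for every $x \in X$ and $d_Y(y, f(g(y))) \le C$ for every $y \in Y$; in that case $X$ and $Y$ are said to be coarsely equivalent. *)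

(* Defs.v *)
From HB Require Import structures.
From mathcomp Require Import all_boot all_order all_algebra.
From mathcomp Require Import all_classical all_reals all_analysis.

Set Implicit Arguments.
Unset Strict Implicit.
Unset Printing Implicit Defensive.

Import Order.TTheory GRing.Theory Num.Theory.

Local Open Scope classical_set_scope.
Local Open Scope ring_scope.

Section AsymptoticDimension.
Context {R : realType} {X : metricType R}.
Implicit Types (A B : set X) (U : set (set X)) (r : R).

(* The values are extended reals: the infimum over an empty product is +oo. *)
Definition set_dist A B : \bar R :=
  ereal_inf [set (mdist p.1 p.2)%:E | p in A `*` B].

Definition r_disjoint r U : Prop :=
  forall A B, U A -> U B -> A <> B -> (r%:E < set_dist A B)%E.

(* The diameter of the empty set is -oo, which does not affect boundedness. *)
Definition diameter A : \bar R :=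
  ereal_sup [set (mdist p.1 p.2)%:E | p in A `*` A].

Definition uniformly_bounded U : Prop :=
  (ereal_sup [set diameter A | A in U] < +oo)%E.

Definition covering U : Prop := \bigcup_(A in U) A = setT.

End AsymptoticDimension.

Definition asdim_le (R : realType) (X : metricType R) (n : nat) : Prop :=
  forall r : R, 0 < r ->
  exists U : set (set X),
    [/\ uniformly_bounded U, covering U &
      exists V : 'I_n.+1 -> set (set X),
        U = \bigcup_(i in [set: 'I_n.+1]) V i /\
        forall i, r_disjoint r (V i)].

Section Coarse.
Context {R : realType}.
Implicit Types X Y : metricType R.

Definition coarse_map X Y (f : X -> Y) : Prop :=
  forall delta : R, 0 < delta ->
  exists2 epsilon : R, 0 < epsilon &
    forall a b : X, mdist a b <= delta -> mdist (f a) (f b) <= epsilon.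

Definition coarse_equivalence X Y (f : X -> Y) : Prop :=
  coarse_map f /\
  exists g : Y -> X, coarse_map g /\
    exists C : R, [/\ 0 < C,
      forall x : X, mdist x (g (f x)) <= C &
      forall y : Y, mdist y (f (g y)) <= C].

Definition coarsely_equivalent X Y : Prop :=
  exists f : X -> Y, coarse_equivalence f.

End Coarse.

Definition property_N2 (R : realType) (n : nat) (Y : metricType R) : Prop :=
  forall (x : Y) (y : 'I_n.+2 -> Y),
  exists i j : 'I_n.+2, i <> j /\ mdist (y i) (y j) <= mdist x (y i).

(* Main.v *)
Require Import Defs.
From HB Require Import structures.
From mathcomp Require Import all_boot all_order all_algebra.
From mathcomp Require Import all_classical all_reals all_analysis.
From mathcomp Require Import lra.

(** The metric [D] is a minimum of [n + 1] ultrametrics, one for each colour of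
    the covers; property (N2)_n is then the pigeonhole principle applied to the
    colours realising the [n + 2] distances [D x (y i)].  The ultrametric of a
    colour [c] is given by an increasing sequence of equivalence relations
    [T k c], bounded by [s k], where [T k.+1 c] merges the classes of [T k c]
    that meet a common member of colour [c] of an enlarged cover whose
    Lebesgue number exceeds [2 * s k] and whose members of equal colour are so
    far apart that no two of them meet the same class of [T k c].  The Lebesgue
    number gives [D x z <= max (D x y) (D y z) + 1], which for an
    integer-valued separating [D] implies the triangle inequality. *)

Set Implicit Arguments.
Unset Strict Implicit.
Unset Printing Implicit Defensive.

Import Order.TTheory GRing.Theory Num.Theory.

Local Open Scope classical_set_scope.
Local Open Scope ring_scope.

Lemma metric_transport (R : realType) (T : choiceType) (d : T -> T -> R) :
  (forall x, d x x = 0) -> (forall x y, d x y = 0 -> x = y) ->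
  (forall x y, d x y = d y x) -> (forall y x z, d x z <= d x y + d y z) ->
  exists (Y : metricType R) (f : T -> Y) (g : Y -> T),
    [/\ cancel f g, cancel g f & forall x y, mdist (f x) (f y) = d x y].
Proof.
move=> dxx dpos dsym dtri.
(* [isMetric.Build R T] does not typecheck when [T] is a variable, hence [T']. *)
pose T' : choiceType := HB.pack_for choiceType (Choice.sort T) (Choice.class T).
pose dT := isMetric.Build R T' dxx dpos dsym dtri.
pose Y : metricType R := HB.pack_for (metricType R) (Choice.sort T') dT.
by exists Y, id, id.
Qed.

(** If [rho x y] and [rho y z] are both nonzero, the smaller is at least 1, so their sum is at least
    their maximum plus 1. If one of them vanishes, two of the three points coincide. *)
Lemma metric_of_quasi_ultrametric (R : realType) (T : choiceType)
    (rho : T -> T -> nat) :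
  (forall x y, rho x y = 0%N <-> x = y) ->
  (forall x y, rho x y = rho y x) ->
  (forall x y z, (rho x z <= (maxn (rho x y) (rho y z)).+1)%N) ->
  exists (Y : metricType R) (f : T -> Y) (g : Y -> T),
    [/\ cancel f g, cancel g f & forall x y, mdist (f x) (f y) = (rho x y)%:R].
Proof.
move=> rho0 rho_sym rho_tri.
apply: (metric_transport (d := fun x y => (rho x y)%:R)).
- by move=> x; rewrite (rho0 x x).2.
- by move=> x y /eqP; rewrite pnatr_eq0 => /eqP /rho0.
- by move=> x y; rewrite rho_sym.
move=> y x z; rewrite -natrD ler_nat.
have [xy0|xy_neq0] := eqVneq (rho x y) 0%N.
  by move/rho0: (xy0) ->; exact: leq_addl.
have [yz0|yz_neq0] := eqVneq (rho y z) 0%N.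
  by move/rho0: (yz0) <-; exact: leq_addr.
apply: leq_trans (rho_tri x y z) _.
rewrite -!lt0n in xy_neq0 yz_neq0.
rewrite gtn_max -[X in (X < _)%N]addn0 ltn_add2l yz_neq0.
by rewrite -addn1 addnC leq_add2r.
Qed.

Section AsymptoticDimensionFacts.
Context {R : realType} {X : metricType R}.
Implicit Types (U : set (set X)) (A B : set X) (T : X -> X -> Prop) (r s : R).

Lemma uniformly_boundedP U : uniformly_bounded U ->
  exists2 b, 0 <= b &
    forall A x y, U A -> A x -> A y -> mdist x y <= b.
Proof.
rewrite /uniformly_bounded; set M := ereal_sup _ => Mfin.
have le_M A x y : U A -> A x -> A y -> ((mdist x y)%:E <= M)%E.
  move=> UA Ax Ay; apply: (@le_trans _ _ (diameter A)).
    by apply: ereal_sup_ubound; exists (x, y).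
  by apply: ereal_sup_ubound; exists A.
exists (Num.max 0 (fine M)) => [|A x y UA Ax Ay]; first by rewrite le_max lexx.
move: Mfin (le_M A x y UA Ax Ay); case: M {le_M} => [m| |] //= _.
by rewrite lee_fin le_max => ->; rewrite orbT.
Qed.

Lemma r_disjoint_eq r U A B x y : r_disjoint r U -> U A -> U B ->
  A x -> B y -> mdist x y <= r -> A = B.
Proof.
move=> disj UA UB Ax By xy_le; apply: contrapT => /(disj _ _ UA UB).
apply/negP; rewrite -leNgt; apply: (@le_trans _ _ (mdist x y)%:E) => //.
by apply: ereal_inf_lbound; exists (x, y).
Qed.

Definition bounded_equivalence s T : Prop :=
  [/\ forall x, T x x, forall x y, T x y -> T y x,
      forall x y z, T x y -> T y z -> T x z &
      forall x y, T x y -> mdist x y <= s].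

(** Thickening all members of a cover by [L] puts every ball of radius [L] inside a single
    member. *)
Definition thickening L A : set X := [set x | exists2 a, A a & mdist x a <= L].

(** Disjointness prevents a class of [T] from meeting the thickenings of two different members of
    [V]. Chains of merged classes therefore never pass from one member to another, so one passage
    through a thickening already gives a transitive relation. *)
Lemma merge_bounded_equivalence (V : set (set X)) (L s b : R) T :
  r_disjoint (2 * L + 2 * s) V ->
  (forall A x y, V A -> A x -> A y -> mdist x y <= b) ->
  bounded_equivalence s T -> 0 <= L -> 0 <= s -> 0 <= b ->
  exists T', [/\ bounded_equivalence (2 * s + 2 * L + b) T',
    forall x y, T x y -> T' x y &
    forall A x y, V A -> thickening L A x -> thickening L A y -> T' x y].
Proof.
move=> disj Vb [Trefl Tsym Ttrans Tb] L0 s0 b0.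
pose T' x y := T x y \/ exists A u v, [/\ V A, T x u, thickening L A u,
  thickening L A v & T v y].
exists T'; split; [|by left|]; last first.
  by move=> A x y VA xA yA; right; exists A, x, y.
split.
- by move=> x; left.
- move=> x y [/Tsym|[A [u [v [VA xu uA vA vy]]]]]; first by left.
  by right; exists A, v, u; split=> //; exact: Tsym.
- move=> x y z [xy|[A [u [v [VA xu uA vA vy]]]]] [yz|].
  + by left; exact: Ttrans yz.
  + case=> A [u [v [VA yu uA vA vz]]].
    by right; exists A, u, v; split => //; exact: Ttrans yu.
  + by right; exists A, u, v; split => //; exact: Ttrans yz.
  + case=> A' [u' [v' [VA' yu' uA' vA' vz']]].
    right; exists A, u, v'; split => //.
    suff -> : A = A' by [].
    (* The chain a, v, y, u', a' has length at most L + s + s + L. *)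
    case: vA => a Aa va; case: uA' => a' A'a' u'a'.
    apply: (r_disjoint_eq disj VA VA' Aa A'a').
    have := metric_triangle a v a'; have := metric_triangle v u' a'.
    have := Tb _ _ vy; have := Tb _ _ yu'; have := metric_triangle v y u'.
    by rewrite (metric_sym a v); lra.
- move=> x y [/Tb|[A [u [v [VA /Tb xu [a Aa ua] [a' Aa' va'] /Tb vy]]]]].
    by lra.
  (* The chain x, u, a, a', v, y has length at most s + L + b + L + s. *)
  have := Vb _ _ _ VA Aa Aa'.
  have := metric_triangle x u y; have := metric_triangle u v y.
  have := metric_triangle u a v; have := metric_triangle a a' v.
  by rewrite (metric_sym a' v); lra.
Qed.

Lemma asdim_merge n (T : 'I_n.+1 -> X -> X -> Prop) (s : R) :
  asdim_le X n -> 0 <= s -> (forall c, bounded_equivalence s (T c)) ->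
  exists (T' : 'I_n.+1 -> X -> X -> Prop) (s' : R),
    [/\ s + 1 <= s', forall c, bounded_equivalence s' (T' c),
      forall c x y, T c x y -> T' c x y &
      forall x y, mdist x y <= 2 * s + 1 -> exists c, T' c x y].
Proof.
move=> asdimX s0 Teq; pose L := 2 * s + 1.
have L0 : 0 <= L by rewrite /L; lra.
have r0 : 0 < 2 * L + 2 * s by rewrite /L; lra.
have [U [/uniformly_boundedP[b b0 Ub] Ucov [V [UV disj]]]] := asdimX _ r0.
have Vb c A x y : V c A -> A x -> A y -> mdist x y <= b.
  by move=> VA; apply: Ub; rewrite UV; exists c.
have /choice[T' T'P] c :=
  merge_bounded_equivalence (disj c) (@Vb c) (Teq c) L0 s0 b0.
exists T', (2 * s + 2 * L + b); split.
- by rewrite /L; lra.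
- by move=> c; have [] := T'P c.
- by move=> c; have [] := T'P c.
(* The colour is that of any member containing [x]; its thickening also contains [y]. *)
move=> x y xyL; have : setT x by [].
rewrite -Ucov UV => -[A [c _ VA] Ax]; exists c.
have [_ _] := T'P c; apply; first exact: VA.
- by exists x; rewrite ?mdistxx.
- by exists x; rewrite // metric_sym.
Qed.

Lemma asdim_equivalences n : asdim_le X n ->
  exists (T : nat -> 'I_n.+1 -> X -> X -> Prop) (s : nat -> R),
    [/\ forall c x y, T 0%N c x y <-> x = y,
      forall k, k%:R <= s k,
      forall k c, bounded_equivalence (s k) (T k c),
      forall k c x y, T k c x y -> T k.+1 c x y &
      forall k x y, mdist x y <= 2 * s k + 1 -> exists c, T k.+1 c x y].
Proof.
move=> asdimX.
(* The invariant is bundled with the data, so that a choice function for one step can be iterated,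
   starting from equality with bound 0. *)
pose good (q : ('I_n.+1 -> X -> X -> Prop) * R) :=
  0 <= q.2 /\ forall c, bounded_equivalence q.2 (q.1 c).
pose step (q q' : {q | good q}) := [/\ (sval q).2 + 1 <= (sval q').2,
  forall c x y, (sval q).1 c x y -> (sval q').1 c x y &
  forall x y, mdist x y <= 2 * (sval q).2 + 1 -> exists c, (sval q').1 c x y].
have good0 : good (fun _ => eq, 0).
  split=> //= c; split=> //; first by move=> x y z -> ->.
  by move=> x _ <-; rewrite mdistxx.
have stepP q : exists q', step q q'.
  case: q => -[T s] gq; have [/= s0 Teq] := gq.
  have [T' [s' [ss' T'eq TT' covT']]] := asdim_merge asdimX s0 Teq.
  have good' : good (T', s') by split=> //=; lra.
  by exists (exist _ _ good').
have [nxt nxtP] := choice stepP.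
pose q k := iter k nxt (exist _ _ good0).
exists (fun k => (sval (q k)).1), (fun k => (sval (q k)).2); split.
- by [].
- elim=> [//|k IHk]; have [+ _ _] := nxtP (q k).
  by rewrite -natr1; apply: le_trans; rewrite lerD2r.
- by move=> k c; have [_] := svalP (q k); apply.
- by move=> k; have [_ + _] := nxtP (q k); apply.
- by move=> k; have [_ _] := nxtP (q k); apply.
Qed.

Lemma asdim_quasi_ultrametric n : asdim_le X n ->
  exists (rho : X -> X -> nat) (s : nat -> R),
    [/\ [/\ forall x y, rho x y = 0%N <-> x = y,
          forall x y, rho x y = rho y x &
          forall x y z, (rho x z <= (maxn (rho x y) (rho y z)).+1)%N],
      forall k, k%:R <= s k,
      forall k x y, (rho x y <= k)%N -> mdist x y <= s k,
      forall k x y, mdist x y <= s k -> (rho x y <= k.+1)%N &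
      forall x (y : 'I_n.+2 -> X), exists i j, i <> j /\
        (rho (y i) (y j) <= rho x (y i))%N].
Proof.
move=> asdimX; have [T [s [T0 sk Teq Tmono Tcov]]] := asdim_equivalences asdimX.
have Tle k l c x y : (k <= l)%N -> T k c x y -> T l c x y.
  elim: l => [|l IHl]; rewrite leq_eqVlt => /orP[/eqP-> //|//].
  by move=> /IHl/[apply]/Tmono.
have s_ge0 k : 0 <= s k by apply: le_trans (sk k).
have Tbig x y : exists k, `[< exists c, T k c x y >].
  have [k xyk] : exists k : nat, mdist x y <= k%:R.
    by exists (Num.bound (mdist x y)); rewrite ltW// archi_boundP// mdist_ge0.
  exists k.+1; apply/asboolP; apply: Tcov.
  by have := sk k; have := s_ge0 k; lra.
(* The first stage at which some colour joins [x] and [y]. *)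
pose rho x y := ex_minn (Tbig x y).
have rhoT x y : exists c, T (rho x y) c x y.
  by rewrite /rho; case: ex_minnP => k /asboolP.
have rho_le k c x y : T k c x y -> (rho x y <= k)%N.
  move=> xyk; rewrite /rho; case: ex_minnP => m _; apply.
  by apply/asboolP; exists c.
have rho_bound k x y : (rho x y <= k)%N -> mdist x y <= s k.
  have [c xyc] := rhoT x y => xyk; have [_ _ _] := Teq k c; apply.
  exact: Tle xyc.
have rho_sym x y : rho x y = rho y x.
  apply/eqP; rewrite eqn_leq; apply/andP; split.
    have [c yx] := rhoT y x; apply: (rho_le _ c).
    by have [_ + _ _] := Teq (rho y x) c; apply.
  have [c xy] := rhoT x y; apply: (rho_le _ c).
  by have [_ + _ _] := Teq (rho x y) c; apply.
exists rho, s; split=> //.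
- split=> //.
  + move=> x y; split=> [xy0|->].
      by have [c] := rhoT x y; rewrite xy0 => /T0.
    by apply/eqP; rewrite -leqn0; apply: (rho_le _ ord0); apply/T0.
  + move=> x y z; set m := maxn _ _.
    have xy : mdist x y <= s m by apply: rho_bound; rewrite leq_maxl.
    have yz : mdist y z <= s m by apply: rho_bound; rewrite leq_maxr.
    (* Here [x] and [z] are at distance at most [2 * s m], so some colour, possibly a new one, joins
       them at stage [m.+1]. *)
    have [|c xzc] := Tcov m x z; last exact: rho_le xzc.
    by have := metric_triangle x y z; lra.
- move=> k x y xyk; have [|c] := Tcov k x y; last exact: rho_le.
  by have := s_ge0 k; lra.
- move=> x y; have /choice[c cP] i := rhoT x (y i).
  have /injectivePn[i [j ij cij]] : ~~ injectiveb c.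
    by apply/negP => /injectiveP/leq_card; rewrite !card_ord ltnn.
  (* Let [y i] be the farther of the two points: at stage [rho x (y i)] the common colour then joins
     [x] to both, hence [y i] to [y j]. *)
  wlog lij : i j ij cij / (rho x (y j) <= rho x (y i))%N.
    move=> wl; have [|/ltnW] := leqP (rho x (y j)) (rho x (y i)); first exact: wl.
    by apply: wl; rewrite // eq_sym.
  exists i, j; split; first exact/eqP.
  apply: (rho_le _ (c i)); have [_ Tsym Ttrans _] := Teq (rho x (y i)) (c i).
  by apply: Ttrans (Tsym _ _ (cP i)) _; rewrite cij; apply: Tle (cP j).
Qed.

End AsymptoticDimensionFacts.

Theorem theorem2p4 (R : realType) (n : nat) (X : metricType R) :
  asdim_le X n ->
  exists Y : metricType R, coarsely_equivalent X Y /\ property_N2 n Y.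
Proof.
move=> /asdim_quasi_ultrametric[rho [s [[rho0 rho_sym rho_tri]]]].
move=> sk rho_bd rho_ge N2.
have [Y [f [g [fK gK fD]]]] :=
  metric_of_quasi_ultrametric R rho0 rho_sym rho_tri.
have gD x y : mdist x y = (rho (g x) (g y))%:R by rewrite -fD !gK.
exists Y; split; last first.
  move=> x y; have [i [j [ij le_ij]]] := N2 (g x) (g \o y).
  by exists i, j; split=> //; rewrite !gD ler_nat.
exists f; split.
  move=> delta delta0; exists (Num.bound delta).+1%:R => // a b ab.
  rewrite fD ler_nat; apply: rho_ge; apply: le_trans ab _.
  by apply: le_trans (sk _); rewrite ltW// archi_boundP// ltW.
exists g; split.
  (* The summand 1 makes the bound strictly positive, since [sk] yields only nonnegativity of
     [s]. *)
  move=> delta delta0; exists (s (Num.bound delta) + 1).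
    by rewrite ltr_wpDl// (le_trans _ (sk _)).
  move=> a b; rewrite gD => ab; rewrite ler_wpDr//; apply: rho_bd.
  rewrite -(ler_nat R); apply: le_trans ab _.
  by rewrite ltW// archi_boundP// ltW.
exists 1; split=> // [x|y].
  by rewrite fK mdistxx.
by rewrite gK mdistxx.
Qed.
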